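(* Consider the remote estimation Markov decision process with state space $\mathbb X$ (either $\mathbb R$ or $\mathbb Z$), action space $[0,u_{\max}]$, horizon $T$, per-step cost $$c(e,u)=\lambda(u)+(1-q(u))\,d(e),$$ and transition density (if $\mathbb X=\mathbb R$) or transition mass function (if $\mathbb X=\mathbb Z$) $$p(e_+|e;u)=q(u)\varphi(e_+)+(1-q(u))\varphi(e_+-ae),$$ where $a\in\mathbb X$ is a constant. Assume: (M0) $q(0)=0$ and $q(u_{\max})\le1$; (M2) $q(\cdot)$ is increasing; (M3) $d(\cdot)$ is even and quasi-convex with $d(0)=0$; (M4) $\varphi(\cdot)$ is even; (M5) $\varphi(\cdot)$ is unimodal (i.e., quasi-concave). Then the value functions $V_t(\cdot)$ and the optimal strategy $g^*_t(\cdot)$, $t\in\{1,\dots,T\}$, are even and quasi-convex.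
   Context: Here $\lambda:[0,u_{\max}]\to\mathbb R$ is the communication cost, $q:[0,u_{\max}]\to[0,1]$ the packet reception probability, $d:\mathbb X\to\mathbb R$ the distortion, and $\varphi$ a probability density on $\mathbb R$ (continuous) if $\mathbb X=\mathbb R$, or a probability mass function on $\mathbb Z$ if $\mathbb X=\mathbb Z$. As for all Markov decision processes considered, the cost $c$ is measurable and lower semi-continuous. The state $E_t$ is the estimation error process, $E_{t+1}=aE_t+W_t$ if the packet sent at time $t$ is lost (probability $1-q(U_t)$) and $E_{t+1}=W_t$ if it is received (probability $q(U_t)$), with $W_t$ i.i.d. with law $\varphi$. The objective is to minimize $\mathbb E\big[\sum_{t=1}^T c(E_t,U_t)\big]$ over strategies $U_t=g_t(E_t)$. The value functions are defined by $V_{T+1}\equiv0$ and, for $t=T,\dots,1$, $$Q_t(e,u)=c(e,u)+\int_{\mathbb X}p(e_+|e;u)V_{t+1}(e_+)\,de_+,\qquad V_t(e)=\min_{u\in[0,u_{\max}]}Q_t(e,u)$$ (the integral is a sum when $\mathbb X=\mathbb Z$), and $g^*_t(e)=\max\{v:v\in\arg\min_{u\in[0,u_{\max}]}Q_t(e,u)\}$. It is implicit that these integrals are well defined, the minima are attained, and the largest minimizers exist. A function $f:\mathbb X\to\mathbb R$ is even and quasi-convex if $f(-x)=f(x)$ for all $x$ and $f(x)\le f(x')$ whenever $0\le x<x'$ in $\mathbb X$. ''Increasing'' means non-decreasing. An even $\varphi$ being unimodal (quasi-concave) means $\varphi(x)\ge\varphi(x')$ whenever $0\le x<x'$ in $\mathbb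 X$. *)

(* Defs.v *)
From HB Require Import structures.
From mathcomp Require Import all_boot all_order all_algebra.
From mathcomp Require Import all_classical all_reals all_analysis.

Set Implicit Arguments.
Unset Strict Implicit.
Unset Printing Implicit Defensive.

Import Order.TTheory GRing.Theory Num.Theory.
Import numFieldNormedType.Exports.

Local Open Scope classical_set_scope.
Local Open Scope ring_scope.

HB.instance Definition _ := isPointed.Build int 0.
HB.instance Definition _ := hasNbhs.Build int principal_filter.
HB.instance Definition _ := Discrete_ofNbhs.Build int erefl.
HB.instance Definition _ := @isMeasurable.Build default_measure_display
  int discrete_measurable discrete_measurable0
  discrete_measurableC discrete_measurableU.

Variant state_space := RealLine | IntegerLine.

Section StateSpace.
Context (R : realType).

Definition carrier (s : state_space) : realDomainType :=
  match s with RealLine => R | IntegerLine => int end.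

(* Sums over the integers are integrals against the counting measure on the
   discrete sigma-algebra, so a sum is well defined (as a real number) exactly
   when it is absolutely convergent. *)
Definition state_integrable (s : state_space) : (carrier s -> R) -> Prop :=
  match s with
  | RealLine => fun f => (@lebesgue_measure R).-integrable setT (EFin \o f)
  | IntegerLine => fun f => (@counting int R).-integrable setT (EFin \o f)
  end.

Definition state_integral (s : state_space) : (carrier s -> R) -> R :=
  match s with
  | RealLine => fun f => \int[@lebesgue_measure R]_x f x
  | IntegerLine => fun f => \int[@counting int R]_k f k
  end.

(* The integral is taken in the extended reals, so that total mass one also
   entails integrability. *)
Definition probability_density (s : state_space) : (carrier s -> R) -> Prop :=
  match s with
  | RealLine => fun phi => [/\ continuous phi, forall x, 0 <= phi x &
      (\int[@lebesgue_measure R]_x (phi x)%:E = 1)%E]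
  | IntegerLine => fun phi => (forall k, 0 <= phi k) /\
      (\int[@counting int R]_k (phi k)%:E = 1)%E
  end.

(* Both properties are relative to the domain on which the cost lives: all
   states, and actions in `[0, umax]. *)
Definition measurable_cost (s : state_space) (umax : R) :
    (carrier s -> R -> R) -> Prop :=
  match s with
  | RealLine => fun c =>
      measurable_fun ([set: R] `*` `[0, umax]) (fun x : R * R => c x.1 x.2)
  | IntegerLine => fun c =>
      measurable_fun ([set: int] `*` `[0, umax]) (fun x : int * R => c x.1 x.2)
  end.

Definition lsc_cost (s : state_space) (umax : R) :
    (carrier s -> R -> R) -> Prop :=
  match s with
  | RealLine => fun c => lower_semicontinuous
      (fun x : subspace ([set: R] `*` `[0, umax]) => (c x.1 x.2)%:E)
  | IntegerLine => fun c => lower_semicontinuous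
      (fun x : subspace ([set: int] `*` `[0, umax]) => (c x.1 x.2)%:E)
  end.

End StateSpace.

Section RemoteEstimation.
Context {R : realType} {s : state_space}.
Local Notation X := (carrier R s).

Definition even_fun (f : X -> R) : Prop := forall x, f (- x) = f x.

Definition even_quasiconvex (f : X -> R) : Prop :=
  even_fun f /\ forall x x', 0 <= x -> x < x' -> f x <= f x'.

Definition unimodal (f : X -> R) : Prop :=
  forall x x', 0 <= x -> x < x' -> f x' <= f x.

Definition remote_cost (lambda q : R -> R) (d : X -> R) (e : X) (u : R) : R :=
  lambda u + (1 - q u) * d e.

Definition remote_transition (a : X) (q : R -> R) (phi : X -> R)
    (eplus e : X) (u : R) : R :=
  q u * phi eplus + (1 - q u) * phi (eplus - a * e).

Definition minimum_of (A : set R) (m : R) : Prop := A m /\ lbound A m.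
Definition maximum_of (A : set R) (m : R) : Prop := A m /\ ubound A m.

Definition argmin (U : set R) (f : R -> R) : set R :=
  [set v | U v /\ forall u, U u -> f v <= f u].

Definition Qfun (c : X -> R -> R) (p : X -> X -> R -> R) (V : nat -> X -> R)
    (t : nat) (e : X) (u : R) : R :=
  c e u + state_integral (fun eplus => p eplus e u * V t.+1 eplus).

(* Backward induction over t = T, ..., 1.  It determines V on {1, ..., T.+1}
   and g on {1, ..., T}; well-definedness of the integrals and existence of
   the minima and of the largest minimizers are part of the predicate. *)
Record dp_solution (umax : R) (T : nat) (c : X -> R -> R)
    (p : X -> X -> R -> R) (V g : nat -> X -> R) : Prop := DPSolution {
  dp_terminal : forall e, V T.+1 e = 0;
  dp_integrable : forall t, (1 <= t <= T)%N ->
    forall e u, u \in `[0, umax] ->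
    state_integrable (fun eplus => p eplus e u * V t.+1 eplus);
  dp_value : forall t, (1 <= t <= T)%N -> forall e,
    minimum_of (Qfun c p V t e @` `[0, umax]) (V t e);
  dp_strategy : forall t, (1 <= t <= T)%N -> forall e,
    maximum_of (argmin `[0, umax] (Qfun c p V t e)) (g t e)
}.

End RemoteEstimation.

(* Main.v *)
Require Import Defs.
From HB Require Import structures.
From mathcomp Require Import all_boot all_order all_algebra.
From mathcomp Require Import all_classical all_reals all_analysis.
From mathcomp Require Import ring lra finmap measurable_realfun.

Import Order.TTheory GRing.Theory Num.Theory.
Import numFieldNormedType.Exports.

Local Open Scope classical_set_scope.
Local Open Scope ring_scope.

(* Put K y = \int phi (x - y) V_{t+1} x dx.  As q 0 = 0, the action u = 0 makes
   every K (a e) well defined, and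
     Q_t(e,u) = (lambda u + q u K 0) + (1 - q u) (d e + K (a e)).
   The reflection x |-> y + y' - x preserves the reference measure and exchanges
   phi (x - y) and phi (x - y'), so that
     2 (K y' - K y) =
       \int (phi (x - y) - phi (x - y')) (V_{t+1} (y + y' - x) - V_{t+1} x) dx,
   and when |y| <= |y'| the two factors always have the same sign.  Hence
   D e = d e + K (a e) is nondecreasing in |e|; so are the minimum over u of
   Q_t(e, .) and, by submodularity of (u, D) |-> (1 - q u) D, its largest
   minimizer. *)

Set Implicit Arguments.
Unset Strict Implicit.
Unset Printing Implicit Defensive.

(** The pushforward of [mu] under [h] is [mu] itself, so this is a change of variables.
    Integrability of [f \o h] comes first, from the nonnegative case applied to the absolute value
    of [f]. *)
Lemma integral_measure_preserving d (T : measurableType d) (R : realType)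
    (mu : {measure set T -> \bar R}) (h : T -> T) (f : T -> \bar R) :
  measurable_fun [set: T] h ->
  (forall A, measurable A -> mu (h @^-1` A) = mu A) ->
  mu.-integrable [set: T] f ->
  mu.-integrable [set: T] (f \o h) /\
  (\int[mu]_x (f \o h) x = \int[mu]_x f x)%E.
Proof.
move=> mh muh fi.
pose h' : {mfun T >-> T} := HB.pack h (isMeasurableFun.Build _ _ _ _ _ mh).
have pushE g : (\int[pushforward mu h']_x g x = \int[mu]_x g x)%E.
  by apply: eq_measure_integral => A mA _; exact: muh.
have /integrableP[mf foo] := fi.
have fhi : mu.-integrable [set: T] (f \o h).
  apply/integrableP; split; first by exact: measurableT_comp.
  move: foo; rewrite -pushE ge0_integral_pushforward//.
  exact: measurableT_comp.
split=> //.
by rewrite -[RHS]pushE integral_pushforward.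
Qed.

(** A measure agreeing with Lebesgue measure on the intervals []u, v]] equals it. Reflection only
    moves the closed endpoint to the other side, which leaves the length unchanged. *)
Lemma lebesgue_measure_reflection (R : realType) (s : R) (A : set R) :
  measurable A -> lebesgue_measure ((fun x => s - x) @^-1` A) = lebesgue_measure A.
Proof.
move=> mA.
have mh : measurable_fun [set: measurableTypeR R]
    (fun x : measurableTypeR R => (s - x : measurableTypeR R)).
  exact: measurable_funB.
pose h : {mfun measurableTypeR R >-> measurableTypeR R} :=
  HB.pack (fun x : measurableTypeR R => (s - x : measurableTypeR R))
    (isMeasurableFun.Build _ _ _ _ _ mh).
rewrite -[LHS]/(pushforward lebesgue_measure h A).
apply/esym/lebesgue_measure_unique => //= _ [[u v]] _ <-.
rewrite /pushforward /=.
have -> : (fun x => s - x) @^-1` `]u, v] = `[s - v, s - u[%classic.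
  by apply/seteqP; split=> x /=; rewrite !in_itv/= => /andP[? ?]; apply/andP; split; lra.
rewrite !lebesgue_measure_itv/= !lte_fin ltrD2l ltrN2.
by case: ifP => // _; rewrite -!EFinD; congr EFin; ring.
Qed.

(** The preimage under [h] is the image under its inverse [k], and an injective image keeps both
    finiteness and cardinality. *)
Lemma counting_preimage_cancel d (T : sigmaRingType d) (R : realType)
    (h k : T -> T) (A : set T) : cancel h k -> cancel k h ->
  @counting T R (h @^-1` A) = @counting T R A.
Proof.
move=> hK kH.
have -> : h @^-1` A = k @` A.
  apply/seteqP; split=> x /=; first by exists (h x).
  by case=> y Ay <-; rewrite kH.
have finE : finite_set (k @` A) = finite_set A.
  apply/propext; split; last exact: finite_image.
  move=> /(finite_image h); rewrite image_comp.
  by rewrite (_ : h \o k = id) ?image_id//; apply/funext => x; exact: kH.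
rewrite /counting finE; case: asboolP => // fA.
by rewrite fset_set_image// card_imfset//; exact: can_inj kH.
Qed.

Lemma Rintegral_linear d (T : measurableType d) (R : realType)
    (mu : {measure set T -> \bar R}) (k l : R) (f h : T -> R) :
  mu.-integrable [set: T] (EFin \o f) -> mu.-integrable [set: T] (EFin \o h) ->
  mu.-integrable [set: T] (EFin \o (fun x => k * f x + l * h x)) /\
  \int[mu]_x (k * f x + l * h x) = k * \int[mu]_x f x + l * \int[mu]_x h x.
Proof.
move=> fi hi.
have iZ m (w : T -> R) : mu.-integrable [set: T] (EFin \o w) ->
    mu.-integrable [set: T] (EFin \o (fun x => m * w x)).
  by move=> wi; have := integrableZl measurableT m wi; apply: eq_integrable.
split; last by rewrite RintegralD ?RintegralZl//; exact: iZ.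
by have := integrableD measurableT (iZ k f fi) (iZ l h hi); apply: eq_integrable.
Qed.

Section StateIntegral.
Context {R : realType} {s : state_space}.
Local Notation X := (carrier R s).
Implicit Types (f h V phi : X -> R).

Lemma state_integral_linear (k l : R) f h :
  state_integrable f -> state_integrable h ->
  state_integrable (fun x => k * f x + l * h x) /\
  state_integral (fun x => k * f x + l * h x) =
    k * state_integral f + l * state_integral h.
Proof. by case: s f h => f h; exact: Rintegral_linear. Qed.

Lemma state_integral_ge0 f : (forall x, 0 <= f x) -> 0 <= state_integral f.
Proof. by case: s f => f f0; apply: Rintegral_ge0. Qed.

Lemma state_integral_reflection (r : X) f : state_integrable f ->
  state_integrable (fun x => f (r - x)) /\
  state_integral (fun x => f (r - x)) = state_integral f.
Proof.
case: s r f => r f fi.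
- have mh : measurable_fun [set: measurableTypeR R] (fun x : R => r - x).
    exact: measurable_funB.
  have [? e] := integral_measure_preserving mh (@lebesgue_measure_reflection R r) fi.
  by split=> //; rewrite /= /Rintegral -e.
- have mh : measurable_fun [set: int] (fun x : int => r - x) by [].
  have hK : involutive (fun x : int => r - x) by move=> x; rewrite subKr.
  have [? e] := integral_measure_preserving mh
    (fun A _ => @counting_preimage_cancel _ _ R _ _ A hK hK) fi.
  by split=> //; rewrite /= /Rintegral -e.
Qed.

(** Monotonicity in the absolute value avoids case splits on signs; evenness is recovered by
    comparing [x] and [- x] both ways. *)
Lemma even_quasiconvexP f :
  even_quasiconvex f <-> forall x y, `|x| <= `|y| -> f x <= f y.
Proof.
split=> [[fN fle] x y|fle].
  have fE z : f `|z| = f z by case: (ger0P z).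
  rewrite -(fE x) -(fE y) le_eqVlt => /predU1P[->//|]; exact: fle.
split=> [x|x y x0 xy]; last by apply: fle; rewrite !ger0_norm// ltW// (le_lt_trans x0).
by apply/eqP; rewrite eq_le !fle// normrN.
Qed.

Lemma even_unimodalP phi : even_fun phi -> unimodal phi ->
  forall x y, `|x| <= `|y| -> phi y <= phi x.
Proof.
move=> phiN phile x y xy; rewrite -lerN2.
have /even_quasiconvexP : even_quasiconvex (fun z => - phi z).
  by split=> [z|z w z0 zw]; [rewrite phiN|rewrite lerN2 phile].
exact.
Qed.

(** After squaring, the two differences to be compared are [(y' - y) * w] and [(y + y') * w] with
    the common factor [w = y + y' - 2 x]. The cofactors have product [y' ^+ 2 - y ^+ 2 >= 0], so
    both differences share a sign. *)
Lemma ler_norm_reflection (y y' x : X) : `|y| <= `|y'| ->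
  (`|x - y| <= `|x - y'|) && (`|x| <= `|y + y' - x|) ||
  (`|x - y'| <= `|x - y|) && (`|y + y' - x| <= `|x|).
Proof.
have le_sqr (z w : X) : (`|z| <= `|w|) = (z ^+ 2 <= w ^+ 2).
  by rewrite -(real_normK (num_real z)) -(real_normK (num_real w)) ler_sqr ?nnegrE.
rewrite !le_sqr => yy'.
have [[dy sy]|[dy sy]] : (0 <= y' - y) /\ (0 <= y + y') \/ (y' - y <= 0) /\ (y + y' <= 0).
  by case: (lerP 0 (y' - y)) (lerP 0 (y + y')) => [? [?|?]|? [?|?]]; nra.
  all: have [w0|w0] := lerP 0 (y + y' - x *+ 2); apply/orP.
  (* Goals 1 and 4 are those where [w] has the same sign as the two cofactors. *)
  1,4: left; apply/andP; split; nra.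
  all: right; apply/andP; split; nra.
Qed.

Lemma convolution_le phi V (y y' : X) :
  even_fun phi -> unimodal phi -> even_quasiconvex V -> `|y| <= `|y'| ->
  state_integrable (fun x => phi (x - y) * V x) ->
  state_integrable (fun x => phi (x - y') * V x) ->
  state_integral (fun x => phi (x - y) * V x) <=
  state_integral (fun x => phi (x - y') * V x).
Proof.
move=> phiN phile /even_quasiconvexP Vle yy' F1 F2.
have {phile}phile := even_unimodalP phiN phile.
have [G1 G1E] := state_integral_reflection (y + y') F1.
have [G2 G2E] := state_integral_reflection (y + y') F2.
have [H1 H1E] := state_integral_linear 1 (-1) G1 F2.
have [H2 H2E] := state_integral_linear 1 (-1) G2 F1.
have [H HE] := state_integral_linear 1 (-1) H2 H1.
(* Two integrands minus the other two, one of each pair reflected: the integral is twice the wanted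
   difference. The factors [1] and [-1] are kept so that [HE], [H1E] and [H2E] match
   syntactically. *)
suff : 0 <= state_integral (fun x =>
    1 * (1 * (phi (y + y' - x - y') * V (y + y' - x)) + -1 * (phi (x - y) * V x))
    + -1 * (1 * (phi (y + y' - x - y) * V (y + y' - x))
            + -1 * (phi (x - y') * V x))).
  by rewrite HE H1E H2E G1E G2E; lra.
apply: state_integral_ge0 => x.
have -> : phi (y + y' - x - y') = phi (x - y) by rewrite -phiN; congr phi; ring.
have -> : phi (y + y' - x - y) = phi (x - y') by rewrite -phiN; congr phi; ring.
(* The integrand is now [(phi (x - y) - phi (x - y')) * (V (y + y' - x) - V x)], and each case gives
   both factors the same sign. *)
by case/orP: (ler_norm_reflection x yy') => /andP[/phile ? /Vle ?]; nra.
Qed.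

(** Passing from [x] to [y] adds [(1 - q u) * (y - x)], which is nonnegative and nonincreasing in
    [u]. The first property orders the minima. By the second, if [gy < gx], then [gx] gains no more
    than [gy] and also minimizes at [y], against the maximality of [gy]. *)
Lemma submodular_min_argmax_le (U : set R) (l q : R -> R) (x y vx vy gx gy : R) :
  {in U &, {homo q : u v / u <= v}} -> (forall u, U u -> q u <= 1) -> x <= y ->
  minimum_of ((fun u => l u + (1 - q u) * x) @` U) vx ->
  minimum_of ((fun u => l u + (1 - q u) * y) @` U) vy ->
  maximum_of (argmin U (fun u => l u + (1 - q u) * x)) gx ->
  maximum_of (argmin U (fun u => l u + (1 - q u) * y)) gy ->
  vx <= vy /\ gx <= gy.
Proof.
move=> qle q1 xy [_ vxle] [[u Uu <-] _] [[Ugx gxmin] _] [[Ugy gymin] gymax].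
split.
  apply: (@le_trans _ _ (l u + (1 - q u) * x)); first by apply: vxle; exists u.
  by have := q1 _ Uu; nra.
rewrite leNgt; apply/negP => gygx.
suff : gx <= gy by lra.
apply: gymax; split=> // w Uw; apply: le_trans (gymin _ Uw).
have := gxmin _ Ugy.
have : q gy <= q gx by apply: qle (ltW gygx); exact: mem_set.
nra.
Qed.

Lemma remote_integrable (umax : R) (T : nat) (a : X) (c : X -> R -> R)
    (q : R -> R) phi (V g : nat -> X -> R) (t : nat) (e : X) :
  0 <= umax -> q 0 = 0 ->
  dp_solution umax T c (remote_transition a q phi) V g ->
  (1 <= t <= T)%N ->
  state_integrable (fun x => phi (x - a * e) * V t.+1 x).
Proof.
move=> umax0 q0 VgP tT; have := dp_integrable VgP tT e (u := 0).
rewrite in_itv/= lexx umax0 => /(_ isT); congr state_integrable.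
by apply/funext => x; rewrite /remote_transition q0; ring.
Qed.

Lemma Qfun_remote (a : X) (lambda q : R -> R) d phi (V : nat -> X -> R)
    (t : nat) (e : X) (u : R) :
  let K y := state_integral (fun x => phi (x - y) * V t.+1 x) in
  (forall y, state_integrable (fun x => phi (x - a * y) * V t.+1 x)) ->
  Qfun (remote_cost lambda q d) (remote_transition a q phi) V t e u =
  (lambda u + q u * K 0) + (1 - q u) * (d e + K (a * e)).
Proof.
(* The state [0] provides the integrability behind [K 0], because [a * 0 = 0]. *)
move=> K Ki; have := Ki 0; rewrite mulr0 => K0i.
have [_ KE] := state_integral_linear (q u) (1 - q u) K0i (Ki e).
rewrite /Qfun /remote_cost.
have -> : state_integral (fun x => remote_transition a q phi x e u * V t.+1 x) =
    q u * K 0 + (1 - q u) * K (a * e).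
  rewrite -KE; congr state_integral; apply/funext => x.
  by rewrite /remote_transition subr0; ring.
ring.
Qed.

End StateIntegral.

Theorem theorem4 (R : realType) (s : state_space) (umax : R) (T : nat)
  (a : carrier R s) (lambda q : R -> R) (d phi : carrier R s -> R)
  (V g : nat -> carrier R s -> R)
  (umax_ge0 : 0 <= umax)
  (q_range : forall u, u \in `[0, umax] -> 0 <= q u <= 1)
  (phi_density : probability_density phi)
  (c_measurable : measurable_cost umax (remote_cost lambda q d))
  (c_lsc : lsc_cost umax (remote_cost lambda q d))
  (M0 : q 0 = 0 /\ q umax <= 1)
  (M2 : forall u v, u \in `[0, umax] -> v \in `[0, umax] ->
        u <= v -> q u <= q v)
  (M3 : even_quasiconvex d /\ d 0 = 0)
  (M4 : even_fun phi)
  (M5 : unimodal phi)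
  (Vg_dp : dp_solution umax T (remote_cost lambda q d)
             (remote_transition a q phi) V g) :
  forall t, (1 <= t <= T)%N ->
    even_quasiconvex (V t) /\ even_quasiconvex (g t).
Proof.
have [q0 _] := M0; have [/even_quasiconvexP dle _] := M3.
have step t : (1 <= t <= T)%N -> even_quasiconvex (V t.+1) ->
    even_quasiconvex (V t) /\ even_quasiconvex (g t).
  move=> tT Vqc.
  have Ki e := remote_integrable e umax_ge0 q0 Vg_dp tT.
  pose K y := state_integral (fun x => phi (x - y) * V t.+1 x).
  have QE e : Qfun (remote_cost lambda q d) (remote_transition a q phi) V t e =
      fun u => (lambda u + q u * K 0) + (1 - q u) * (d e + K (a * e)).
    by apply/funext => u; exact: Qfun_remote.
  have Vg_le e e' : `|e| <= `|e'| -> V t e <= V t e' /\ g t e <= g t e'.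
    move=> ee'.
    have De : d e + K (a * e) <= d e' + K (a * e').
      by rewrite lerD ?dle ?convolution_le// !normrM ler_wpM2l.
    (* Only the second summand in [QE] depends on the state: [lambda u + q u * K 0] serves as [l],
       and the two sides of [De] as [x] and [y]. *)
    have := dp_strategy Vg_dp tT e'; have := dp_strategy Vg_dp tT e.
    have := dp_value Vg_dp tT e'; have := dp_value Vg_dp tT e; rewrite !QE.
    apply: submodular_min_argmax_le De.
    - by move=> u v /set_mem uU /set_mem vU; exact: M2.
    - by move=> u /q_range/andP[].
  by split; apply/even_quasiconvexP => e e' /Vg_le[].
(* Backward induction, run upwards on the number [k] of remaining stages: [k = 0] is the terminal
   function, and [k <= T] keeps the subtraction from truncating. *)
have Vqc k : (k <= T)%N -> even_quasiconvex (V (T - k).+1).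
  elim: k => [_|k IH kT].
    by rewrite subn0; split=> [x|x x' _ _]; rewrite !(dp_terminal Vg_dp).
  have tT : (1 <= T - k <= T)%N by rewrite subn_gt0 kT leq_subr.
  have [] := step _ tT (IH (ltnW kT)).
  by rewrite subnSK.
move=> t tT; apply: step => //.
have [t1 tT'] := andP tT.
by rewrite -(subKn tT'); exact/Vqc/leq_subr.
Qed.
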